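(* If $X$ is a Banach space such that $X^*$ fails the $(-1)$-ball covering property, then $\mathrm{SCD}(B_X)=\emptyset$.
   Context: Banach spaces are over $\mathbb{K}=\mathbb{R}$ or $\mathbb{C}$; $B_X$, $S_X$, $X^*$ denote the closed unit ball, the unit sphere and the topological dual of $X$. A slice of a bounded set $A\subseteq X$ is a non-empty intersection of $A$ with an open half-space; it can be written as $S(A,x^*,\alpha)=\{x\in A:\operatorname{Re}x^*(x)>\sup_{b\in A}\operatorname{Re}x^*(b)-\alpha\}$ with $x^*\in X^*$, $\alpha>0$. Let $A\subseteq X$ be bounded and convex and $a\in A$. A countable collection $\{V_n:n\in\mathbb{N}\}$ of non-empty subsets of $A$ is determining for $a$ if $a\in\overline{\mathrm{conv}}(B)$ whenever $B\subseteq A$ intersects all the sets $V_n$. The point $a$ is an SCD point (slicely countably determined point) of $A$ if there is a sequence of slices of $A$ that is determining for $a$; $\mathrm{SCD}(A)$ is the set of all SCD points of $A$. A Banach space $Z$ fails the $(-1)$-ball covering property if for every separable subspace $Y$ of $Z$ there is $z\in S_Z$ such that $\|y+\lambda z\|=\|y\|+|\lambda|$ for all $y\in Y$ and $\lambda\in\mathbb{R}$. *)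

(* Defs.v *)
From HB Require Import structures.
From mathcomp Require Import all_boot all_order all_algebra.
From mathcomp Require Import complex.
From mathcomp Require Import boolp classical_sets functions cardinality reals.
From mathcomp Require Import topology normedtype.

Set Implicit Arguments.
Unset Strict Implicit.
Unset Printing Implicit Defensive.

Import Order.TTheory GRing.Theory Num.Theory.
Import numFieldNormedType.Exports.

Local Open Scope classical_set_scope.
Local Open Scope ring_scope.

Variant scalar_kind := RealScalars | ComplexScalars.

(* The scalar field, either the reals or the complex numbers over them.  The
   norm of a [normedModType K] is [K]-valued; [realPart] and [ofReal] move
   between [K] and [R]. *)
Definition scalarField (R : realType) (k : scalar_kind) : numFieldType :=
  match k with RealScalars => R | ComplexScalars => R[i] end.

Section Scalars.
Variables (R : realType) (k : scalar_kind).

Definition realPart : scalarField R k -> R :=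
  match k return scalarField R k -> R with
  | RealScalars => fun x => x
  | ComplexScalars => fun x => complex.Re x
  end.

Definition ofReal : R -> scalarField R k :=
  match k return R -> scalarField R k with
  | RealScalars => fun x => x
  | ComplexScalars => fun x => real_complex R x
  end.

Lemma ofRealK : cancel ofReal realPart.
Proof. by rewrite /ofReal /realPart; case: k. Qed.

Lemma realPart_ofReal (x : scalarField R k) :
  x \is Num.real -> ofReal (realPart x) = x.
Proof.
by rewrite /ofReal /realPart; case: k x => //= x; exact: RRe_real.
Qed.

Lemma ofReal0 : ofReal 0 = 0.
Proof. by rewrite /ofReal; case: k. Qed.

Lemma ler_ofReal x y : (ofReal x <= ofReal y) = (x <= y).
Proof. by rewrite /ofReal; case: k => //=; rewrite lecR. Qed.

Lemma ofReal_norm_real (V : normedModType (scalarField R k)) (x : V) :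
  ofReal (realPart `|x|) = `|x|.
Proof. by rewrite realPart_ofReal // ger0_real. Qed.

End Scalars.

Section Dual.
Variables (R : realType) (k : scalar_kind).
Local Notation K := (scalarField R k).
Variable X : normedModType K.

Definition unit_ball : set X := [set x | `|x| <= 1].

Definition unit_sphere : set X := [set x | `|x| = 1].

(* [pred] is boolean-valued, hence the [asbool] brackets, and [K^o] is [K] seen
   as a normed module over itself. *)
Definition is_dual : pred (X -> K^o) :=
  fun f => `[< scalar f /\ continuous f >].

Record dual := Dual { dual_fun :> X -> K^o ; _ : is_dual dual_fun }.

HB.instance Definition _ := [isSub for dual_fun].
HB.instance Definition _ := [Choice of dual by <:].

Lemma is_dual_submod_closed : submod_closed is_dual.
Proof.
split.
  apply/asboolP; split; first by move=> a x y; rewrite /= mulr0 addr0.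
  exact: cst_continuous.
move=> a f g /asboolP[lf cf] /asboolP[lg cg]; apply/asboolP; split.
  move=> b x y; rewrite /= !fctE lf lg !scalerDr /GRing.scale /= !mulrDr.
  by rewrite (mulrCA a b) addrACA.
move=> x; apply: cvgD; last exact: cg.
by apply: cvgZr; exact: cf.
Qed.

HB.instance Definition _ :=
  GRing.isSubmodClosed.Build K (X -> K^o) is_dual is_dual_submod_closed.
HB.instance Definition _ := [SubChoice_isSubLmodule of dual by <:].

Lemma dual_linear (f : dual) : linear (dual_fun f).
Proof. by case: f => f /= /asboolP[lf _] a x y; exact: lf. Qed.

Lemma dual_continuous (f : dual) : continuous (dual_fun f).
Proof. by case: f => f /= /asboolP[]. Qed.

HB.instance Definition _ (f : dual) :=
  GRing.isLinear.Build K X K^o *:%R (dual_fun f) (dual_linear f).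

Lemma dual_ext (f g : dual) : dual_fun f =1 dual_fun g -> f = g.
Proof. by move=> fg; apply: val_inj; apply/funext. Qed.

Definition dual_values (f : dual) : set R :=
  [set realPart `|f x| | x in unit_ball].

Definition dual_norm (f : dual) : K := ofReal k (sup (dual_values f)).

Lemma dual_values0 (f : dual) : dual_values f 0.
Proof.
exists 0; first by rewrite /unit_ball /= normr0.
by rewrite linear0 normr0 -(ofReal0 R k) ofRealK.
Qed.

Lemma dual_has_sup (f : dual) : has_sup (dual_values f).
Proof.
split; first by exists 0; exact: dual_values0.
have fb : bounded_near f (nbhs (0 : X)).
  by apply/linear_bounded_continuous; exact: dual_continuous.
have [M fM] := (bounded_funP f).2 fb 1.
exists (realPart M) => _ [x x1 <-].
have xM := fM x x1.
have Mr : M \is Num.real by rewrite ger0_real // (le_trans _ xM).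
by rewrite -(ler_ofReal k) ofReal_norm_real realPart_ofReal.
Qed.

Lemma dual_norm_ub (f : dual) (x : X) : `|x| <= 1 -> `|f x| <= dual_norm f.
Proof.
move=> x1; rewrite /dual_norm -ofReal_norm_real ler_ofReal.
by apply: sup_upper_bound; [exact: dual_has_sup|exists x].
Qed.

Lemma dual_norm_le (f : dual) (M : K) :
  (forall x, `|x| <= 1 -> `|f x| <= M) -> dual_norm f <= M.
Proof.
move=> fM.
have M0 : 0 <= M by rewrite (le_trans _ (fM 0 _)) // normr0.
rewrite /dual_norm -(realPart_ofReal (ger0_real M0)) ler_ofReal.
apply: ge_sup; first by exists 0; exact: dual_values0.
move=> _ [x x1 <-].
by rewrite -(ler_ofReal k) ofReal_norm_real realPart_ofReal ?fM // ger0_real.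
Qed.

Lemma dual_norm_ge0 (f : dual) : 0 <= dual_norm f.
Proof. by apply: le_trans (dual_norm_ub f (x := 0) _); rewrite ?normr0. Qed.

Lemma dual_normD (f g : dual) : dual_norm (f + g) <= dual_norm f + dual_norm g.
Proof.
apply: dual_norm_le => x x1.
have -> : (f + g : dual) x = f x + g x by [].
by rewrite (le_trans (ler_normD _ _)) // lerD // dual_norm_ub.
Qed.

Lemma dual_normZ (a : K) (f : dual) : dual_norm (a *: f) = `|a| * dual_norm f.
Proof.
have afE x : (a *: f : dual) x = a * f x by [].
have [->|a0] := eqVneq a 0.
  rewrite normr0 mul0r scale0r; apply: le_anti; rewrite dual_norm_ge0 andbT.
  by apply: dual_norm_le => x _; rewrite normr0.
apply: le_anti; apply/andP; split.
  by apply: dual_norm_le => x x1; rewrite afE normrM ler_wpM2l // dual_norm_ub.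
rewrite mulrC -ler_pdivlMr ?normr_gt0 //; apply: dual_norm_le => x x1.
by rewrite ler_pdivlMr ?normr_gt0 // mulrC -normrM -afE dual_norm_ub.
Qed.

Lemma dual_norm0_eq0 (f : dual) : dual_norm f = 0 -> f = 0.
Proof.
move=> f0; apply: dual_ext => x.
have -> : (0 : dual) x = 0 by [].
have [->|x0] := eqVneq x 0; first by rewrite linear0.
have nx0 : `|x| != 0 by rewrite normr_eq0.
have : `|f (`|x|^-1 *: x)| <= 0.
  by rewrite -f0 dual_norm_ub // normrZ normfV normr_id mulVf.
rewrite normr_le0 linearZ /= mulf_eq0 invr_eq0 (negbTE nx0) /=.
by move/eqP.
Qed.

HB.instance Definition _ :=
  Lmodule_isNormed.Build K dual dual_normD dual_normZ dual_norm0_eq0.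

Lemma dual_normE (f : dual) :
  `|f| = ofReal k (sup [set realPart `|f x| | x in unit_ball]).
Proof. by []. Qed.

End Dual.

Arguments unit_ball {R k} X.
Arguments unit_sphere {R k} X.

Section SCD.
Variables (R : realType) (k : scalar_kind).
Local Notation K := (scalarField R k).
Variable X : normedModType K.

(* A non-zero functional is required, so the trivial space has no half-space. *)
Definition open_half_space (H : set X) :=
  exists (f : dual X) (c : R), f != 0 /\ H = [set x | c < realPart (f x)].

Definition is_slice (A S : set X) :=
  S !=set0 /\ exists2 H, open_half_space H & S = A `&` H.

(* [0 <= t i] in [K] forces [t i] to be real, also when [K] is [R[i]]. *)
Definition conv_hull (B : set X) : set X :=
  [set x | exists (n : nat) (t : 'I_n -> K) (b : 'I_n -> X),
    [/\ forall i, 0 <= t i, \sum_(i < n) t i = 1, forall i, B (b i)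
      & x = \sum_(i < n) t i *: b i]].

Definition determining (A : set X) (V : nat -> set X) (a : X) :=
  (forall n, V n !=set0 /\ V n `<=` A) /\
  forall B, B `<=` A -> (forall n, B `&` V n !=set0) -> closure (conv_hull B) a.

Definition SCD (A : set X) : set X :=
  [set a | A a /\
    exists2 V : nat -> set X, (forall n, is_slice A (V n)) & determining A V a].

Definition separable_set (Y : set X) :=
  exists D : set X, [/\ countable D, D `<=` Y & Y `<=` closure D].

(* Failure of the (-1)-ball covering property; [Y] ranges over the [K]-linear
   subspaces, closed or not. *)
Definition fails_m1BCP :=
  forall Y : set X, submod_closed (mem Y) -> separable_set Y ->
    exists2 z, unit_sphere X z &
      forall y (l : R), Y y ->
        `|y + ofReal k l *: z| = `|y| + ofReal k `|l|.

End SCD.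

(* Main.v *)
Require Import Defs.
From mathcomp Require Import all_boot all_order all_algebra.
From mathcomp Require Import complex.
From mathcomp Require Import boolp classical_sets functions cardinality reals.
From mathcomp Require Import topology normedtype.
From mathcomp Require Import lra.

(** Let [a] be a point of the unit ball for which the slices
    [V n = {x in the ball | c n < Re (f n x)}] are determining.  The linear span
    of the countably many functionals [f n] is a separable subspace of the dual
    ([seq_span_separable]), so there is a norm-one functional [z] with
    [|f n + z| = |f n| + 1] and [|f n - z| = |f n| + 1] for all [n].

    Such additivity of norms means that [f n] and [z] almost attain their norms
    at a common point of the ball ([common_norming_point]): the value of
    [Re (f n + z)] is close to [|f n| + |z|] only if neither summand loses much.
    Since [V n] is non-empty, [c n < |f n|], so [V n] contains a point where
    [Re z > 1/2].  Thus the slice [{Re z > 1/2}] of the ball meets every [V n],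
    and [a] belongs to its closed convex hull, whence [Re (z a) >= 1/2]
    ([determined_half_space]).  The same applies to [- z] and yields
    [Re (z a) <= - 1/2], a contradiction. *)

Import Order.TTheory GRing.Theory Num.Theory.
Import numFieldNormedType.Exports.

Local Open Scope classical_set_scope.
Local Open Scope ring_scope.

(** * Real parts and rational approximation of scalars *)

Section ScalarField.
Context {R : realType} {k : scalar_kind}.
Local Notation K := (scalarField R k).
Implicit Types (a b : K) (l m : R).

Lemma realPartD a b : realPart (a + b) = realPart a + realPart b.
Proof. by move: a b; case: k => //= -[x y] [u v]. Qed.

Lemma realPartN a : realPart (- a) = - realPart a.
Proof. by move: a; case: k => //= -[x y]. Qed.

Lemma realPart_ofRealM l a : realPart (ofReal k l * a) = l * realPart a.
Proof. by move: a; case: k => //= -[x y] /=; rewrite mul0r subr0. Qed.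

Lemma realPart_sum (I : finType) (F : I -> K) :
  realPart (\sum_i F i) = \sum_i realPart (F i).
Proof.
apply: (big_morph _ realPartD).
by rewrite -(ofReal0 R k) ofRealK.
Qed.

Lemma ofRealM l m : ofReal k (l * m) = ofReal k l * ofReal k m.
Proof. by case: k => //=; rewrite rmorphM. Qed.

Lemma ofReal1 : ofReal k 1 = 1 :> K.
Proof. by case: k. Qed.

Lemma ofRealN l : ofReal k (- l) = - ofReal k l.
Proof. by case: k => //=; rewrite rmorphN. Qed.

Lemma ltr_ofReal l m : (ofReal k l < ofReal k m) = (l < m).
Proof. by case: k => //=; rewrite ltcR. Qed.

Lemma realPart1 : realPart (1 : K) = 1.
Proof. by rewrite -ofReal1 ofRealK. Qed.

Lemma realPart_le_norm a : realPart a <= realPart `|a|.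
Proof.
move: a; case: k => [a|[x y]] /=; first exact: ler_norm.
by rewrite (le_trans (ler_norm x))// -sqrtr_sqr ler_wsqrtr// lerDl sqr_ge0.
Qed.

Lemma realPart_ge0 a : 0 <= a -> 0 <= realPart a.
Proof.
by move=> a0; rewrite -(ler_ofReal k) ofReal0 realPart_ofReal // ger0_real.
Qed.

Lemma realPart_le_ofReal a l : `|a| <= ofReal k l -> realPart a <= l.
Proof.
move=> al; apply: le_trans (realPart_le_norm a) _.
by rewrite -(ler_ofReal k) realPart_ofReal // ger0_real.
Qed.

(** Zero over the reals, so that [ratScalar] below has one formula for both
    fields. *)
Definition imagUnit : K :=
  match k return scalarField R k with
  | RealScalars => 0
  | ComplexScalars => 'i%C
  end.

Definition ratScalar (q : rat * rat) : K :=
  ofReal k (ratr q.1) + imagUnit * ofReal k (ratr q.2).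

Lemma ratr_approx (x e : R) : 0 < e -> exists q : rat, `|x - ratr q| < e.
Proof.
move=> e0; have [|q] := @rat_in_itvoo R (x - e) (x + e); first by lra.
by rewrite in_itv /= => qx; exists q; rewrite ltr_norml; lra.
Qed.

(** The Gaussian rationals are dense in the complex numbers: it is enough to
    approximate the real and imaginary parts, since the modulus is at most the
    sum of their absolute values. *)
Lemma ratScalar_approx a (e : K) : 0 < e -> exists q, `|a - ratScalar q| < e.
Proof.
rewrite /ratScalar /imagUnit; move: a e; case: k => /= [x|[x y]] e e0.
  have [q xq] := ratr_approx x _ e0.
  by exists (q, 0); rewrite mul0r addr0.
have er : e = (complex.Re e)%:C%C by rewrite RRe_real // gtr0_real.
have e20 : 0 < complex.Re e / 2 by rewrite divr_gt0 // -ltcR -er.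
have [p xp] := ratr_approx x _ e20; have [q yq] := ratr_approx y _ e20.
exists (p, q) => /=; rewrite er.
have -> : (x +i* y)%C - ((ratr p)%:C%C + 'i%C * (ratr q)%:C%C)
    = (x - ratr p)%:C%C + 'i%C * (y - ratr q)%:C%C.
  apply/eqP; rewrite eq_complex /=.
  by rewrite !(mul0r, mul1r, subr0, addr0, add0r, oppr0) !eqxx.
apply: le_lt_trans (ler_normD _ _) _; rewrite normrM.
have -> : `|'i%C| = 1 :> R[i].
  by rewrite normc_def /= expr0n expr1n add0r sqrtr1.
rewrite mul1r.
have normC (t : R) : `|t%:C%C| = `|t|%:C%C.
  by rewrite normc_def /= expr0n addr0 sqrtr_sqr.
by rewrite !normC -rmorphD ltcR; lra.
Qed.

End ScalarField.

(** * The span of a sequence is separable *)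

Lemma closure_normP (F : numFieldType) (V : normedModType F) (A : set V)
    (p : V) :
  closure A p <-> forall e : F, 0 < e -> exists2 y, A y & `|p - y| < e.
Proof.
split=> [Ap e e0|Ap B /nbhs_ballP[e /= e0 eB]].
  have [y [Ay py]] := Ap _ (nbhsx_ballx p e e0).
  by exists y => //; move: py; rewrite -ball_normE.
have [y Ay py] := Ap e e0; exists y; split => //.
by apply: eB; rewrite -ball_normE.
Qed.

Section SequenceSpan.
Context {R : realType} {k : scalar_kind}.
Local Notation K := (scalarField R k).
Context {V : normedModType K}.
Implicit Type f : nat -> V.

Definition seq_span f : set V :=
  [set y | exists n (a : nat -> K), y = \sum_(i < n) a i *: f i].

Lemma mem_seq_span f n : seq_span f (f n).
Proof.
exists n.+1, (fun i => (i == n)%:R); rewrite big_ord_recr /= eqxx scale1r.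
by rewrite big1 ?add0r // => i _; rewrite ltn_eqF // scale0r.
Qed.

(** Padding with zero coefficients brings two combinations to a common
    length, so that they can be added. *)
Lemma seq_span_widen f n m (a : nat -> K) : (n <= m)%N ->
  exists b : nat -> K, \sum_(i < n) a i *: f i = \sum_(i < m) b i *: f i.
Proof.
move=> nm; exists (fun i => if (i < n)%N then a i else 0).
rewrite (big_ord_widen m (fun i => a i *: f i)) // big_mkcond /=.
by apply: eq_bigr => i _; case: ifP; rewrite ?scale0r.
Qed.

Lemma seq_span_submod_closed f : submod_closed (mem (seq_span f)).
Proof.
split; first by rewrite inE; exists 0%N, (fun=> 0); rewrite big_ord0.
move=> c _ _ /set_mem[n [a ->]] /set_mem[m [b ->]]; apply/mem_set.
have [a' ->] := seq_span_widen f _ _ a (leq_maxl n m).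
have [b' ->] := seq_span_widen f _ _ b (leq_maxr n m).
exists (maxn n m), (fun i => c * a' i + b' i).
rewrite scaler_sumr -big_split /=; apply: eq_bigr => i _.
by rewrite scalerDl scalerA.
Qed.

(** Combinations with rational coefficients are dense: moving every coefficient
    by less than [d] moves the sum by at most [d] times the sum of the norms of
    the vectors.  Indexing these combinations by finite sequences of pairs of
    rationals makes countability immediate. *)
Lemma seq_span_separable f : separable_set (seq_span f).
Proof.
pose comb (s : seq (rat * rat)) : V :=
  \sum_(i < size s) ratScalar (nth 0 s i) *: f i.
exists (range comb); split.
- exact: sub_countable (card_image_le _ _) (countableP _).
- by move=> _ [s _ <-]; exists (size s), (fun i => ratScalar (nth 0 s i)).
move=> _ [n [a ->]]; apply/closure_normP => e e0.
(* The summand 1 keeps [M] positive when all the vectors vanish. *)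
pose M := 1 + \sum_(i < n) `|f i|.
have M0 : 0 < M by rewrite ltr_pwDl // sumr_ge0.
have eM0 : 0 < e / M by rewrite divr_gt0.
have /choice[q aq] i := ratScalar_approx (a i) _ eM0.
exists (comb (mkseq q n)); first by exists (mkseq q n).
rewrite /comb size_mkseq -sumrB.
have le_diff : `|\sum_(i < n) (a i *: f i - ratScalar (mkseq q n)`_i *: f i)|
    <= e / M * \sum_(i < n) `|f i|.
  rewrite (le_trans (ler_norm_sum _ _ _)) // mulr_sumr; apply: ler_sum => i _.
  by rewrite nth_mkseq // -scalerBl normrZ ler_wpM2r // ltW.
apply: le_lt_trans le_diff _.
by rewrite mulrAC ltr_pdivrMr // ltr_pM2l // ltrDr.
Qed.

End SequenceSpan.

(** * Functionals on the unit ball *)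

Section DualBall.
Context {R : realType} {k : scalar_kind}.
Local Notation K := (scalarField R k).
Context {X : normedModType K}.
Implicit Types (f z : dual X) (x a : X).

Lemma dual_norm_le_mul f x : `|f x| <= `|f| * `|x|.
Proof.
have [->|x0] := eqVneq x 0; first by rewrite linear0 !normr0 mulr0.
have nx0 : 0 < `|x| by rewrite normr_gt0.
rewrite -ler_pdivrMr //.
have -> : `|f x| / `|x| = `|f (`|x|^-1 *: x)|.
  by rewrite linearZ /= normrM normfV normr_id mulrC.
by apply: dual_norm_ub; rewrite normrZ normfV normr_id mulVf ?gt_eqF.
Qed.

Lemma realPart_dual_ball f x :
  unit_ball X x -> realPart (f x) <= realPart `|f|.
Proof.
by move=> x1; apply: realPart_le_ofReal; rewrite ofReal_norm_real dual_norm_ub.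
Qed.

(** The supremum of [Re f] over the ball is the norm of [f], although the norm
    is defined from the modulus of [f]: the ball is invariant under
    multiplication by scalars of modulus one, and such a scalar turns [f x] into
    its modulus. *)
Lemma dual_realPart_approx f (c : R) : c < realPart `|f| ->
  exists2 x, unit_ball X x & c < realPart (f x).
Proof.
move=> cf; apply: contrapT => nx; move: cf; apply/negP; rewrite -leNgt.
rewrite -(ler_ofReal k) ofReal_norm_real; apply: dual_norm_le => x x1.
have [y y1 fy] : exists2 y, unit_ball X y & f y = `|f x|.
  have [fx0|fx0] := eqVneq (f x) 0; first by exists x; rewrite ?fx0 ?normr0.
  exists ((`|f x| / f x) *: x); last first.
    by rewrite linearZ /= /GRing.scale /= divfK.
  rewrite /unit_ball /= normrZ normrM normfV normr_id divff ?mul1r //.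
  by rewrite normr_eq0.
rewrite -ofReal_norm_real ler_ofReal -fy leNgt; apply/negP => cy.
by apply: nx; exists y.
Qed.

(** Take [x] in the ball with [Re ((f + z) x)] close to [|f| + |z|].  As
    [Re (f x) <= |f|] and [Re (z x) <= |z|], each term has to be close to its
    own bound. *)
Lemma common_norming_point f z (c d : R) :
  `|f + z| = `|f| + `|z| -> c < realPart `|f| -> d < realPart `|z| ->
  exists x, [/\ unit_ball X x, c < realPart (f x) & d < realPart (z x)].
Proof.
move=> fz cf dz.
have [|x x1] := dual_realPart_approx (f + z)
    (Num.max (c + realPart `|z|) (realPart `|f| + d)).
  by rewrite fz realPartD gt_max ltrD2r ltrD2l cf dz.
have -> : (f + z : dual X) x = f x + z x by [].
rewrite realPartD gt_max => /andP[cx dx].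
have fx := realPart_dual_ball f x x1; have zx := realPart_dual_ball z x x1.
by exists x; split => //; lra.
Qed.

(** Closed half-spaces are convex and closed, so they contain the closed convex
    hull of each of their subsets. *)
Lemma closure_conv_hull_half_space z (B : set X) (c : R) a :
  (forall x, B x -> c <= realPart (z x)) ->
  closure (conv_hull B) a -> c <= realPart (z a).
Proof.
move=> Bc /closure_normP aB; apply/ler_addgt0Pr => e e0.
pose M := 1 + realPart `|z|.
have M0 : 0 < M by rewrite ltr_pwDl // realPart_ge0.
have [|_ [n [t [b [t0 t1 Bb ->]]]] ay] := aB (ofReal k (e / M)).
  by rewrite -(ofReal0 R k) ltr_ofReal divr_gt0.
set y := \sum_(i < n) _ in ay.
have cy : c <= realPart (z y).
  rewrite linear_sum realPart_sum -[c]mulr1 -(realPart1 (k := k)) -t1.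
  rewrite realPart_sum mulr_sumr; apply: ler_sum => i _.
  rewrite linearZ /= /GRing.scale /= -{2}(realPart_ofReal (ger0_real (t0 i))).
  by rewrite realPart_ofRealM mulrC ler_wpM2l ?Bc // realPart_ge0.
have zay : realPart (z y - z a) <= e.
  apply: realPart_le_ofReal; rewrite -linearB.
  rewrite (le_trans (dual_norm_le_mul _ _)) //.
  rewrite distrC (le_trans (ler_wpM2l _ (ltW ay))) //.
  rewrite -ofReal_norm_real -ofRealM ler_ofReal mulrCA ger_pMr //.
  by rewrite ler_pdivrMr // mul1r lerDr.
move: zay; rewrite realPartD realPartN; lra.
Qed.

(** The slice of the ball where [d < Re z] meets every [V n], by
    [common_norming_point]; hence the point determined by the [V n] lies in the
    closed convex hull of that slice. *)
Lemma determined_half_space (V : nat -> set X) (f : nat -> dual X)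
    (c : nat -> R) z (d : R) a :
  (forall n, V n = unit_ball X `&` [set x | c n < realPart (f n x)]) ->
  determining (unit_ball X) V a ->
  (forall n, `|f n + z| = `|f n| + `|z|) -> d < realPart `|z| ->
  d <= realPart (z a).
Proof.
move=> VE [V0 Va] fz dz.
apply: (closure_conv_hull_half_space z
  (unit_ball X `&` [set x | d < realPart (z x)])).
  by move=> x [_ /ltW].
apply: Va => [x []//|n].
have cf : c n < realPart `|f n|.
  have [[x]] := V0 n; rewrite VE => -[x1 cx] _.
  exact: lt_le_trans cx (realPart_dual_ball _ _ x1).
have [x [x1 fx zx]] := common_norming_point _ _ _ _ (fz n) cf dz.
by exists x; rewrite VE.
Qed.

End DualBall.

(** * The unit ball has no SCD point *)

Theorem theorem2p24 (R : realType) (k : scalar_kind)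
    (X : completeNormedModType (scalarField R k)) :
  fails_m1BCP (dual X) -> SCD (unit_ball X) = set0.
Proof.
move=> failsX; apply/seteqP; split => // a [_ [V sliceV Va]].
have /choice[f /choice[c VE]] n : exists (f : dual X) (c : R),
    V n = unit_ball X `&` [set x | c < realPart (f x)].
  by have [_ [_ [f [c [_ ->]]] VE]] := sliceV n; exists f, c.
have [z z1 fz] :=
  failsX _ (seq_span_submod_closed f) (seq_span_separable f).
have half : 1 / 2 < realPart `|z| by rewrite z1 realPart1; lra.
have za : 1 / 2 <= realPart (z a).
  apply: (determined_half_space _ _ _ _ _ _ VE Va) half => n.
  have := fz (f n) 1 (mem_seq_span f n).
  by rewrite normr1 ofReal1 scale1r => ->; rewrite z1.
have Nza : 1 / 2 <= realPart ((- z : dual X) a).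
  apply: (determined_half_space _ _ _ _ _ _ VE Va); last by rewrite normrN.
  move=> n; have := fz (f n) (- 1) (mem_seq_span f n).
  by rewrite normrN1 ofRealN ofReal1 scaleN1r normrN => ->; rewrite z1.
have NzaE : (- z : dual X) a = - z a by [].
by move: za Nza; rewrite NzaE realPartN; lra.
Qed.
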